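(* Suppose $H$ is a closed normal subgroup of a Polish group $G$, let $\pi\colon G\to G/H$ be the quotient map, and assume that the left coarse structure $\mathcal E_L(G/H)$ of the quotient group $G/H$ is metrisable. Then the following are equivalent. (1) The left coarse structure $\mathcal E_L(G/H)$ equals the quotient coarse structure $\mathcal E_q(G/H)$ of the left coarse structure $\mathcal E_L(G)$ on $G$. (2) Every $\mathcal E_L(G/H)$-bounded set $B\subseteq G/H$ is of the form $B=\pi[A]$ for some bounded set $A\subseteq G$. (3) $H$ is $\sigma$-cobounded in $G$, that is, $G=\bigcup_{n=1}^\infty HA_n$ for some sequence of bounded subsets $A_n\subseteq G$. (4) There is a modest section $\phi\colon G/H\to G$ for the quotient map $\pi$.
   Context: A coarse structure on a set $X$ is an ideal $\mathcal E$ of subsets of $X\times X$ (closed under subsets and finite unions) containing the diagonal and closed under transposition $E\mapsto E^{\sf T}$ and composition $E\circ F=\{(x,z): \exists y\ (x,y)\in E,\ (y,z)\in F\}$. A pseudometric $d$ on $X$ induces the coarse structure $\mathcal E_d(X)=\{E\subseteq X\times X:\sup_{(x,y)\in E}d(x,y)<\infty\}$; a coarse structure is metrisable if it equals $\mathcal E_d(X)$ for some metric $d$. A set $A\subseteq X$ is $\mathcal E$-bounded if $A\times A\in\mathcal E$. A map $\phi\colon(X,\mathcal E)\to(Y,\mathcal F)$ is controlled if $(\phi\times\phi)[E]\in\mathcal F$ for all $E\in\mathcal E$. For a topological group $G$, the left coarse structure is $\mathcal E_L(G)=\bigcap_d\mathcal E_d(G)$, where $d$ ranges over all continuous left-invariant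 pseudometrics on $G$. A subset of $G$ is called bounded if it is $\mathcal E_L(G)$-bounded, i.e., has finite diameter with respect to every continuous left-invariant pseudometric on $G$. If $H$ is a closed normal subgroup, $G/H$ is the topological quotient group and $\mathcal E_L(G/H)$ is its left coarse structure, while $\mathcal E_q(G/H)$ is the smallest coarse structure on $G/H$ making $\pi\colon (G,\mathcal E_L(G))\to G/H$ controlled. A section for $\pi$ is a function $\phi\colon G/H\to G$ with $\pi\circ\phi=\mathrm{id}_{G/H}$; it is modest if $\phi[B]$ is bounded in $G$ whenever $B\subseteq G/H$ is $\mathcal E_L(G/H)$-bounded. *)

(* Defs.v *)
From HB Require Import structures.
From mathcomp Require Import all_boot all_order all_algebra.
From mathcomp Require Import all_classical all_reals all_analysis.

Set Implicit Arguments.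
Unset Strict Implicit.
Unset Printing Implicit Defensive.

Import Order.TTheory GRing.Theory Num.Theory.
Import numFieldNormedType.Exports.

Local Open Scope classical_set_scope.
Local Open Scope quotient_scope.
Local Open Scope group_scope.

HB.structure Definition PreTopologicalGroup := {G of Topological G & Group G}.

HB.mixin Record PreTopologicalGroup_isTopologicalGroup G
    & PreTopologicalGroup G := {
  mulg_continuous : continuous (fun xy : G * G => xy.1 * xy.2) ;
  invg_continuous : continuous (fun x : G => x^-1)
}.

#[short(type="topologicalGroupType")]
HB.structure Definition TopologicalGroup :=
  {G of PreTopologicalGroup G & PreTopologicalGroup_isTopologicalGroup G}.

HB.mixin Record isConjClosed (G : groupType) (S : {pred G}) := {
  gpred_conj : forall x y : G, x \in S -> x ^ y \in S
}.

(* Decidability of membership is no restriction: every normal subgroup given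
   as a classical set is the extension of such a boolean predicate. *)
#[short(type="normalSubgroup")]
HB.structure Definition NormalSubgroup (G : groupType) :=
  {S of GroupClosed G S & isConjClosed G S}.

Section QuotientGroup.
Variables (G : groupType) (H : normalSubgroup G).

Definition coset_equiv (x y : G) := x^-1 * y \in H.

Lemma coset_equiv_is_equiv : equiv_class_of coset_equiv.
Proof.
split=> [x|x y|y x z]; rewrite /coset_equiv.
- by rewrite mulVg gpred1.
- by rewrite -[LHS]gpredV invgM invgK.
- by move=> yx xz; have := gpredM _ _ yx xz; rewrite mulgA mulgK.
Qed.

Canonical coset_equiv_equiv := EquivRelPack coset_equiv_is_equiv.
Canonical coset_equiv_encModRel := defaultEncModRel coset_equiv.

Definition coset_quot := {eq_quot coset_equiv}.
HB.instance Definition _ := EqQuotient.on coset_quot.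
HB.instance Definition _ := Choice.on coset_quot.

Definition coset_one : coset_quot := \pi_coset_quot 1.
Definition coset_inv (a : coset_quot) : coset_quot := \pi_coset_quot (repr a)^-1.
Definition coset_mul (a b : coset_quot) : coset_quot :=
  \pi_coset_quot (repr a * repr b).

Lemma coset_piP (x y : G) :
  (\pi_coset_quot x = \pi_coset_quot y) <-> x^-1 * y \in H.
Proof. by split=> [/eqmodP|xy]; [|apply/eqmodP]. Qed.

Lemma repr_coset (x : G) : x^-1 * repr (\pi_coset_quot x) \in H.
Proof. by apply/coset_piP; rewrite reprK. Qed.

Lemma coset_piV (x : G) : coset_inv (\pi_coset_quot x) = \pi_coset_quot x^-1.
Proof.
apply/coset_piP; rewrite invgK.
have := gpred_conj _ x^-1 (repr_coset x).
rewrite conjgE invgK mulgA mulgA mulgV mul1g.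
by [].
Qed.

Lemma coset_piM (x y : G) : coset_mul (\pi_coset_quot x) (\pi_coset_quot y) = \pi_coset_quot (x * y).
Proof.
apply/esym/coset_piP; rewrite invgM.
set a := repr _; set b := repr _.
have -> : y^-1 * x^-1 * (a * b) = (x^-1 * a) ^ y * (y^-1 * b).
  by rewrite conjgE !mulgA mulgK.
by apply: gpredM; [apply: gpred_conj|]; exact: repr_coset.
Qed.

Lemma coset_mulA : associative coset_mul.
Proof.
move=> a b c; elim/quotW: a => x; elim/quotW: b => y; elim/quotW: c => z.
by rewrite (coset_piM y z) (coset_piM x y) (coset_piM x) coset_piM mulgA.
Qed.

Lemma coset_mul1 : left_id coset_one coset_mul.
Proof. by elim/quotW => x; rewrite coset_piM mul1g. Qed.

Lemma coset_mulr1 : right_id coset_one coset_mul.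
Proof. by elim/quotW => x; rewrite coset_piM mulg1. Qed.

Lemma coset_mulV : left_inverse coset_one coset_inv coset_mul.
Proof. by elim/quotW => x; rewrite coset_piV coset_piM mulVg. Qed.

Lemma coset_mulrV : right_inverse coset_one coset_inv coset_mul.
Proof. by elim/quotW => x; rewrite coset_piV coset_piM mulgV. Qed.

HB.instance Definition _ := isGroup.Build coset_quot
  coset_mulA coset_mul1 coset_mulr1 coset_mulV coset_mulrV.

End QuotientGroup.

Section TopologicalQuotientGroup.
Variables (G : topologicalGroupType) (H : normalSubgroup G).

Definition quotient_group := quotient_topology (coset_quot H).
HB.instance Definition _ := Quotient.on quotient_group.
HB.instance Definition _ := Topological.on quotient_group.
HB.instance Definition _ := Group.copy quotient_group (coset_quot H).

Definition quotient_map : G -> quotient_group := \pi_quotient_group.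

Lemma quotient_mapM : {morph quotient_map : x y / x * y}.
Proof. by move=> x y; rewrite -[LHS]coset_piM. Qed.

Lemma quotient_mapV : {morph quotient_map : x / x^-1}.
Proof. by move=> x; rewrite -[LHS]coset_piV. Qed.

Lemma quotient_map_eq (x y : G) :
  quotient_map x = quotient_map y <-> x^-1 * y \in H.
Proof. exact: coset_piP. Qed.

Lemma quotient_map_surj (a : quotient_group) : exists x, quotient_map x = a.
Proof. by exists (repr a); rewrite /quotient_map reprK. Qed.

Lemma quotient_map_continuous : continuous quotient_map.
Proof. exact: pi_continuous. Qed.

Lemma quotient_map_open (U : set G) : open U -> open (quotient_map @` U).
Proof.
move=> Uop; rewrite /open /= /quotient_open.
have -> : \pi_quotient_group @^-1` (quotient_map @` U) =
    \bigcup_(h in [set` H]) ((fun x => x * h) @^-1` U).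
  apply/seteqP; split => [x [u Uu /esym/quotient_map_eq xu]|x [h Hh Uxh]].
    by exists (x^-1 * u) => //=; rewrite mulgA mulgV mul1g.
  exists (x * h) => //; apply/esym/quotient_map_eq.
  by rewrite mulgA mulVg mul1g.
apply: bigcup_open => h _; apply: open_comp => // x _.
apply: (@continuous_comp _ _ _ (fun x => (x, h)) (fun xy : G * G => xy.1 * xy.2)).
  by apply: cvg_pair; [exact: cvg_id|exact: cvg_cst].
exact: mulg_continuous.
Qed.

Lemma quotient_mul_continuous :
  continuous (fun ab : quotient_group * quotient_group => ab.1 * ab.2).
Proof.
move=> [a b] W; have [x <-] := quotient_map_surj a.
have [y <-] := quotient_map_surj b.
rewrite /= -quotient_mapM => nW.
have nW' : nbhs (x * y) (quotient_map @^-1` W) := quotient_map_continuous nW.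
have [[U V] /= [nU nV] UV] := mulg_continuous (x, y) _ nW'.
have nbhs_image z (A : set G) :
    nbhs z A -> nbhs (quotient_map z) (quotient_map @` A°).
  move=> nA; apply: open_nbhs_nbhs; split.
    by apply: quotient_map_open; exact: open_interior.
  by exists z => //; exact: nbhs_interior.
exists (quotient_map @` U°, quotient_map @` V°).
  by split; exact: nbhs_image.
move=> [_ _] /= [[u Uu <-] [v Vv <-]]; rewrite -quotient_mapM.
by apply: (UV (u, v)); split; exact: interior_subset.
Qed.

Lemma quotient_inv_continuous : continuous (fun a : quotient_group => a^-1).
Proof.
apply/quotient_continuous => x.
have -> : (fun a : quotient_group => a^-1) \o \pi_quotient_group =
    quotient_map \o (fun x : G => x^-1).
  by apply/funext => y /=; rewrite quotient_mapV.
apply: continuous_comp; first exact: invg_continuous.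
exact: quotient_map_continuous.
Qed.

HB.instance Definition _ :=
  PreTopologicalGroup_isTopologicalGroup.Build quotient_group
    quotient_mul_continuous quotient_inv_continuous.

End TopologicalQuotientGroup.

Section Metrics.
Local Open Scope ring_scope.
Variables (R : realType) (X : Type).

Definition is_pseudometric (d : X -> X -> R) :=
  [/\ forall x y, 0 <= d x y,
      forall x, d x x = 0,
      forall x y, d x y = d y x &
      forall x y z, d x z <= d x y + d y z].

Definition is_metric (d : X -> X -> R) :=
  is_pseudometric d /\ forall x y, d x y = 0 -> x = y.

End Metrics.

Section Polish.
Local Open Scope ring_scope.
Variables (R : realType) (T : topologicalType).

Definition separable_space := exists2 D : set T, countable D & dense D.

Definition metric_induces_topology (d : T -> T -> R) :=
  forall x : T,
    nbhs x = filter_from [set e : R | 0 < e] (fun e => [set y | d x y < e]).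

Definition metric_complete (d : T -> T -> R) :=
  forall u : nat -> T,
    (forall e, 0 < e ->
       exists N, forall m n, (N <= m)%N -> (N <= n)%N -> d (u m) (u n) < e) ->
    exists l, forall e, 0 < e ->
       exists N, forall n, (N <= n)%N -> d (u n) l < e.

Definition polish_space :=
  separable_space /\
  exists d : T -> T -> R,
    [/\ is_metric d, metric_induces_topology d & metric_complete d].

End Polish.

Section Coarse.
Variable X : Type.

Definition rel_transpose (E : set (X * X)) : set (X * X) :=
  [set xy | E (xy.2, xy.1)].

Definition rel_comp (E F : set (X * X)) : set (X * X) :=
  [set xz | exists y, E (xz.1, y) /\ F (y, xz.2)].

Definition coarse_structure (E : set (set (X * X))) :=
  [/\ E [set xy | xy.1 = xy.2],
      forall A B, A `<=` B -> E B -> E A,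
      forall A B, E A -> E B -> E (A `|` B),
      forall A, E A -> E (rel_transpose A) &
      forall A B, E A -> E B -> E (rel_comp A B)].

(* Bounded above rather than finite supremum, so that the empty relation
   belongs to the coarse structure. *)
Definition metric_coarse (R : realType) (d : X -> X -> R) :
    set (set (X * X)) :=
  [set E | has_ubound [set d xy.1 xy.2 | xy in E]].

Definition coarse_metrisable (R : realType) (E : set (set (X * X))) :=
  exists2 d : X -> X -> R, is_metric d & E = metric_coarse d.

Definition coarse_bounded (E : set (set (X * X))) (A : set X) := E (A `*` A).

End Coarse.

Section Controlled.
Variables X Y : Type.

Definition controlled (E : set (set (X * X))) (F : set (set (Y * Y)))
    (phi : X -> Y) :=
  forall A, E A -> F [set (phi xy.1, phi xy.2) | xy in A].

Definition quotient_coarse (E : set (set (X * X))) (phi : X -> Y) :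
    set (set (Y * Y)) :=
  \bigcap_(F in [set F | coarse_structure F /\ controlled E F phi]) F.

End Controlled.

Lemma quotient_coarse_structure (X Y : Type) (E : set (set (X * X)))
  (phi : X -> Y) : coarse_structure (quotient_coarse E phi).
Proof.
split.
- by move=> F [[]].
- by move=> A B AB EB F FP; case: (FP) => -[_ sub _ _ _] _; apply: sub (EB F FP).
- move=> A B EA EB F FP; case: (FP) => -[_ _ U _ _] _.
  by apply: U; [exact: EA|exact: EB].
- by move=> A EA F FP; case: (FP) => -[_ _ _ tr _] _; apply: tr; exact: EA.
- move=> A B EA EB F FP; case: (FP) => -[_ _ _ _ C] _.
  by apply: C; [exact: EA|exact: EB].
Qed.

Lemma quotient_coarse_controlled (X Y : Type) (E : set (set (X * X)))
  (phi : X -> Y) : controlled E (quotient_coarse E phi) phi.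
Proof. by move=> A EA F [_]; apply. Qed.

Section GroupCoarse.
Variables (R : realType) (G : topologicalGroupType).

Definition continuous_left_invariant_pseudometric (d : G -> G -> R) :=
  [/\ is_pseudometric d,
      continuous (fun xy : G * G => d xy.1 xy.2) &
      forall g x y, d (g * x) (g * y) = d x y].

Definition left_coarse : set (set (G * G)) :=
  \bigcap_(d in continuous_left_invariant_pseudometric) metric_coarse d.

Definition group_bounded (A : set G) := coarse_bounded left_coarse A.

Definition sigma_cobounded (H : set G) :=
  exists A : nat -> set G,
    (forall n, group_bounded (A n)) /\
    [set: G] = \bigcup_n [set h * a | h in H & a in A n].

End GroupCoarse.

Arguments left_coarse R G : clear implicits.

Section Sections.
Variables (R : realType) (G : topologicalGroupType) (H : normalSubgroup G).

Definition is_section (phi : quotient_group H -> G) :=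
  forall b, quotient_map H (phi b) = b.

Definition modest (phi : quotient_group H -> G) :=
  forall B, group_bounded R B -> group_bounded R (phi @` B).

End Sections.

(* Main.v *)
Require Import Defs.
From HB Require Import structures.
From mathcomp Require Import all_boot all_order all_algebra.
From mathcomp Require Import all_classical all_reals all_analysis.
From mathcomp Require Import lra.

(** A set is bounded in the left coarse structure iff [x |-> d 1 x] is bounded on
it for every continuous left-invariant pseudometric [d], so bounded sets are
stable under products, and a relation is in [left_coarse] iff the set of
quotients [x^-1 y] it determines is bounded. Hence the quotient structure
consists of the relations whose quotients lie in the image of a bounded set of
[G]; this gives (1) => (2) and (4) => (1). A metric for the quotient exhausts
[G/H] by countably many bounded sets cofinal among the bounded sets, which gives
(2) => (3) and reduces (4) to (2).

For (3) => (2), let [q : G -> G/H] and [G = \bigcup_n H A_n]. By Baire some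
[H A_n] is non-meagre. Working with saturated sets of [G] rather than in [G/H],
a Souslin scheme shows that [H A], [A] the closure of [A_n], is comeagre in a
nonempty open set, so that by Pettis' argument [q(A A^-1)] is a neighbourhood of
1. Starting from it and repeatedly adjoining the sets [q(A_n)] and taking
threefold products yields an increasing sequence of images of bounded sets
covering [G/H], extended below by small neighbourhoods of 1. The
Birkhoff-Kakutani construction applied to this two-sided chain gives a
continuous left-invariant pseudometric on [G/H] all of whose balls are contained
in images of bounded sets of [G]. *)

Local Open Scope classical_set_scope.

Set Implicit Arguments.
Unset Strict Implicit.

Import Order.TTheory GRing.Theory Num.Theory numFieldNormedType.Exports.

(** * Bounded sets and the quotient coarse structure *)

Section BoundedSets.
Context {R : realType}.
Local Open Scope ring_scope.
Local Open Scope group_scope.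
Implicit Types G : topologicalGroupType.

(** Passing through [1] bounds the diameter by [M + M]; conversely [d 1 a0] plus the diameter bounds
    all distances from [1]. *)
Lemma group_boundedP G (A : set G) :
  group_bounded R A <->
  forall d : G -> G -> R, continuous_left_invariant_pseudometric d ->
    exists M, forall a, A a -> (d 1 a <= M).
Proof.
split=> [Ab d dP|Ab d dP].
  have [[d0 dxx dC dT] _ _] := dP.
  have [->|/set0P[a0 Aa0]] := eqVneq A set0; first by exists 0.
  have [M Mub] := Ab d dP; exists (d 1 a0 + M) => a Aa.
  apply: (le_trans (dT _ a0 _)); rewrite lerD2l.
  by apply: Mub; exists (a0, a).
have [[d0 dxx dC dT] _ _] := dP.
have [M MA] := Ab d dP; exists (M + M) => _ [[x y] [/= Ax Ay] <-].
by rewrite (le_trans (dT _ 1 _))// lerD ?MA// dC MA.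
Qed.

(** Left invariance gives [d x y = d 1 (x^-1 * y)]. *)
Lemma left_coarseP G (E : set (G * G)) :
  left_coarse R G E <-> group_bounded R [set xy.1^-1 * xy.2 | xy in E].
Proof.
rewrite group_boundedP; split=> Eb d dP; have [_ _ dL] := dP.
  have [M Mub] := Eb d dP; exists M => _ [[x y] Exy <-].
  by rewrite -(dL x) mulg1 mulgA mulgV mul1g; apply: Mub; exists (x, y).
have [M Mub] := Eb d dP; exists M => _ [[x y] Exy <-] /=.
by rewrite -(dL x^-1) mulVg; apply: Mub; exists (x, y).
Qed.

Lemma group_bounded_sub G (A B : set G) :
  A `<=` B -> group_bounded R B -> group_bounded R A.
Proof.
move=> AB /group_boundedP Bb; apply/group_boundedP => d /Bb[M MB].
by exists M => a /AB/MB.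
Qed.

Lemma group_bounded1 G (x : G) : group_bounded R [set x].
Proof. by apply/group_boundedP => d _; exists (d 1 x) => _ ->. Qed.

Lemma group_boundedU G (A B : set G) :
  group_bounded R A -> group_bounded R B -> group_bounded R (A `|` B).
Proof.
move=> /group_boundedP Ab /group_boundedP Bb; apply/group_boundedP => d dP.
have [[M MA] [N NB]] := (Ab d dP, Bb d dP).
by exists (Num.max M N) => x [/MA|/NB] le; rewrite le_max le ?orbT.
Qed.

Lemma group_boundedM G (A B : set G) :
  group_bounded R A -> group_bounded R B ->
  group_bounded R [set a * b | a in A & b in B].
Proof.
move=> /group_boundedP Ab /group_boundedP Bb; apply/group_boundedP => d dP.
have [[M MA] [N NB]] := (Ab d dP, Bb d dP).
have [[_ _ _ dT] _ dL] := dP.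
exists (M + N) => _ [a Aa [b Bb' <-]].
apply: (le_trans (dT _ a _)); rewrite lerD ?MA//.
by rewrite -[a in d a _]mulg1 dL NB.
Qed.

Lemma group_boundedV G (A : set G) :
  group_bounded R A -> group_bounded R [set a^-1 | a in A].
Proof.
move=> /group_boundedP Ab; apply/group_boundedP => d dP.
have [M MA] := Ab d dP; have [[_ _ dC _] _ dL] := dP.
by exists M => _ [a Aa <-]; rewrite -(dL a) mulg1 mulgV dC MA.
Qed.

Lemma left_invariant_pseudometric_continuousr G (d : G -> G -> R) x :
  continuous_left_invariant_pseudometric d -> continuous (d x).
Proof.
move=> [_ dcont _] y.
apply: (@continuous_comp _ _ _ (fun y => (x, y)) (fun xy : G * G => d xy.1 xy.2)).
  by apply: cvg_pair; [exact: cvg_cst|exact: cvg_id].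
exact: dcont.
Qed.

Lemma group_bounded_closure G (A : set G) :
  group_bounded R A -> group_bounded R (closure A).
Proof.
move=> /group_boundedP Ab; apply/group_boundedP => d dP.
have [M MA] := Ab d dP; exists M => x clAx.
have : closed [set y | d 1 y <= M].
  apply: (closed_comp (f := d 1) (D := [set r | r <= M])) => [y _|].
    exact: left_invariant_pseudometric_continuousr.
  exact: closed_le.
by apply; apply: closureS clAx => a /MA.
Qed.

End BoundedSets.

(** * Images and lifts of bounded sets in the quotient group *)

Section Quotients.
Context {R : realType} {G : topologicalGroupType} (H : normalSubgroup G).
Local Open Scope ring_scope.
Local Open Scope group_scope.
Local Notation q := (quotient_map H).

Lemma quotient_map1 : q 1 = 1.
Proof. by apply: (mulgI (q 1)); rewrite -quotient_mapM !mulg1. Qed.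

Lemma pullback_left_invariant_pseudometric (d : quotient_group H -> quotient_group H -> R) :
  continuous_left_invariant_pseudometric d ->
  continuous_left_invariant_pseudometric (fun x y => d (q x) (q y)).
Proof.
move=> [[d0 dxx dC dT] dcont dL]; split=> [|[x y]|g x y].
- by split=> // x y z; exact: dT.
- apply: (@continuous_comp _ _ _ (fun xy : G * G => (q xy.1, q xy.2))
      (fun ab : quotient_group H * quotient_group H => d ab.1 ab.2)); last exact: dcont.
  apply: (@cvg_pair _ _ _ _ (nbhs (q x)) (nbhs (q y)) _ _ _
      (fun xy : G * G => q xy.1) (fun xy : G * G => q xy.2)).
    by apply: continuous_comp; [exact: cvg_fst|exact: quotient_map_continuous].
  by apply: continuous_comp; [exact: cvg_snd|exact: quotient_map_continuous].
- by rewrite !quotient_mapM dL.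
Qed.

Lemma group_bounded_quotient (A : set G) :
  group_bounded R A -> group_bounded R (q @` A).
Proof.
move=> /group_boundedP Ab; apply/group_boundedP => d.
move=> /pullback_left_invariant_pseudometric/Ab[M MA].
by exists M => _ [a Aa <-]; have := MA a Aa; rewrite quotient_map1.
Qed.

(* The relations [E_A = {(x, y) : x^-1 y \in A}], [A] bounded, generate the left
   coarse structure; their images generate the quotient coarse structure. *)
Lemma quotient_coarseP (E : set (quotient_group H * quotient_group H)) :
  quotient_coarse (left_coarse R G) q E <->
  exists2 A : set G, group_bounded R A &
    forall a b, E (a, b) -> (q @` A) (a^-1 * b).
Proof.
split=> [|[A Ab EA] F [/= [_ Fsub _ _ _] Fq]]; last first.
  have SL : left_coarse R G [set xy | A (xy.1^-1 * xy.2)].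
    apply/left_coarseP; apply: group_bounded_sub Ab.
    by move=> _ [xy Axy <-].
  apply: Fsub (Fq _ SL) => -[a b] /EA[x Ax xab].
  exists (repr a, repr a * x) => /=; first by rewrite mulgA mulVg mul1g.
  have qr c : q (repr c) = c by rewrite /quotient_map reprK.
  by rewrite quotient_mapM qr xab mulgA mulgV mul1g.
(* The relations on the right form a coarse structure making [q] controlled, so they include the
   smallest such structure. *)
pose F := [set E : set (quotient_group H * quotient_group H) |
  exists2 A : set G, group_bounded R A &
    forall a b, E (a, b) -> (q @` A) (a^-1 * b)].
move=> QE; apply: (QE F); split; last first.
  move=> E' /left_coarseP Eb'; exists [set xy.1^-1 * xy.2 | xy in E'] => //.
  move=> _ _ [[x y] Exy [<- <-]] /=; exists (x^-1 * y); first by exists (x, y).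
  by rewrite quotient_mapM quotient_mapV.
split.
- exists [set 1]; first exact: group_bounded1.
  by move=> a b /= ->; exists 1 => //; rewrite mulVg quotient_map1.
- by move=> B C BC [A Ab CA]; exists A => // a b /BC/CA.
- move=> B C [A Ab BA] [A' Ab' CA']; exists (A `|` A'); first exact: group_boundedU.
  by move=> a b [/BA[x Ax <-]|/CA'[x Ax <-]]; exists x => //; [left|right].
- move=> B [A Ab BA]; exists [set x^-1 | x in A]; first exact: group_boundedV.
  move=> a b /BA[x Ax xab]; exists x^-1; first by exists x.
  by rewrite quotient_mapV xab invgM invgK.
- move=> B C [A Ab BA] [A' Ab' CA'].
  exists [set x * y | x in A & y in A']; first exact: group_boundedM.
  move=> a c [b /= [/BA[x Ax xab] /CA'[y Ay ybc]]].
  exists (x * y); first by exists x => //; exists y.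
  by rewrite quotient_mapM xab ybc mulgA mulgK.
Qed.

Lemma quotient_coarse_sub_left_coarse :
  quotient_coarse (left_coarse R G) q `<=` left_coarse R (quotient_group H).
Proof.
move=> E /quotient_coarseP[A /group_bounded_quotient Ab EA].
apply/left_coarseP; apply: group_bounded_sub Ab => _ [[a b] Eab <-].
exact: EA.
Qed.

(** Condition (2) of the theorem. *)
Definition bounded_lifting := forall B : set (quotient_group H),
  group_bounded R B -> exists2 A : set G, group_bounded R A & B = q @` A.

Lemma bounded_lifting_sub : (forall B : set (quotient_group H),
  group_bounded R B -> exists2 A : set G, group_bounded R A & B `<=` q @` A) ->
  bounded_lifting.
Proof.
move=> lift B /lift[A Ab BA]; exists (A `&` q @^-1` B).
  by apply: group_bounded_sub Ab => x [].
apply/seteqP; split=> [b Bb|_ [x [_ Bx] <-] //].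
by have [x Ax xb] := BA b Bb; exists x => //; split; rewrite //= xb.
Qed.

(** Applied to the square of [B], the hypothesis puts all [b0^-1 * b] in the image of one bounded
    set; a lift of [b0] translates it back. *)
Lemma coarse_quotient_lifting :
  left_coarse R (quotient_group H) = quotient_coarse (left_coarse R G) q ->
  bounded_lifting.
Proof.
move=> LQ; apply: bounded_lifting_sub => B Bb.
have [->|/set0P[b0 Bb0]] := eqVneq B set0.
  by exists [set 1]; [exact: group_bounded1|exact: sub0set].
have [x0 x0b0] := quotient_map_surj b0.
have : quotient_coarse (left_coarse R G) q (B `*` B) by rewrite -LQ.
move=> /quotient_coarseP[A Ab BA].
exists [set x * y | x in [set x0] & y in A].
  by apply: group_boundedM => //; exact: group_bounded1.
move=> b Bb'; have [|x Ax xb] := BA b0 b; first by split.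
exists (x0 * x); first by exists x0 => //; exists x.
by rewrite quotient_mapM x0b0 xb mulgA mulgV mul1g.
Qed.

(** Take closed balls about [1] of natural radius. A bounded [C] containing [c] lies within
    [d 1 c + M] of [1], where [M] bounds [d] on [C]. *)
Lemma metric_coarse_exhaustion :
  coarse_metrisable R (left_coarse R (quotient_group H)) ->
  exists B : nat -> set (quotient_group H),
    [/\ forall n, group_bounded R (B n),
        forall m n, (m <= n)%N -> B m `<=` B n &
        forall C, group_bounded R C -> exists n, C `<=` B n].
Proof.
move=> [d [[d0 dxx dC dT] _] Ed].
exists (fun n => [set a | d 1 a <= n%:R]); split.
- move=> n; rewrite /group_bounded /coarse_bounded Ed.
  exists (n%:R + n%:R) => _ [[a b] [/= an bn] <-].
  by rewrite (le_trans (dT _ 1 _))// lerD// dC.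
- by move=> m n mn a /= /le_trans; apply; rewrite ler_nat.
- move=> C; have [->|/set0P[c Cc]] := eqVneq C set0; first by exists 0.
  rewrite /group_bounded /coarse_bounded Ed => -[M MC].
  exists (Num.bound (d 1 c + M)) => a Ca /=.
  apply: (@le_trans _ _ (d 1 c + M)).
    by apply: (le_trans (dT _ c _)); rewrite lerD2l; apply: MC; exists (c, a).
  apply/ltW/archi_boundP; rewrite addr_ge0//.
  by apply: (le_trans (d0 c c)); apply: MC; exists (c, c).
Qed.

Lemma lifting_sigma_cobounded :
  coarse_metrisable R (left_coarse R (quotient_group H)) ->
  bounded_lifting -> sigma_cobounded R [set` H].
Proof.
move=> /metric_coarse_exhaustion[B [Bb _ BC]] /(_ _ (Bb _))/cid2 lift.
exists (fun n => s2val (lift n)); split=> [n|]; first exact: (s2valP (lift n)).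
apply/esym/seteqP; split=> // x _.
have [n /(_ _ erefl)] := BC _ (group_bounded1 (q x)).
rewrite (s2valP' (lift n)) => -[a Aa /quotient_map_eq ax]; exists n => //.
(* Normality turns [a^-1 * x \in H] into [x * a^-1 \in H]. *)
exists (x * a^-1); last by exists a; rewrite ?mulgVK.
by have := gpred_conj _ a^-1 ax; rewrite conjgE invgK !mulgA mulgV mul1g.
Qed.

Lemma modest_section_coarse (phi : quotient_group H -> G) :
  is_section phi -> modest R phi ->
  left_coarse R (quotient_group H) = quotient_coarse (left_coarse R G) q.
Proof.
move=> phiK phiB; apply/seteqP; split; last exact: quotient_coarse_sub_left_coarse.
move=> E /left_coarseP/phiB phiE; apply/quotient_coarseP.
exists (phi @` [set ab.1^-1 * ab.2 | ab in E]) => // a b Eab.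
exists (phi (a^-1 * b)); last exact: phiK.
by exists (a^-1 * b) => //; exists (a, b).
Qed.

(** Send [b] to a preimage in [A n], for the least [n] such that [B n] contains [b]. A set inside
    [B n] then lands in the union of the [A i] with [i <= n], which is bounded. *)
Lemma lifting_modest_section :
  coarse_metrisable R (left_coarse R (quotient_group H)) ->
  bounded_lifting -> exists2 phi : quotient_group H -> G, is_section phi & modest R phi.
Proof.
move=> /metric_coarse_exhaustion[B [Bb Bmono BC]] /(_ _ (Bb _))/cid2 lift.
pose A n := s2val (lift n).
have Ab n : group_bounded R (A n) := s2valP (lift n).
have BA n : B n = q @` A n := s2valP' (lift n).
have ex_n b : exists n, `[< B n b >].
  by have [n /(_ _ erefl) Bn] := BC _ (group_bounded1 b); exists n; apply/asboolP.
have ex_x b : exists2 x, A (ex_minn (ex_n b)) x & q x = b.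
  by case: ex_minnP => n /asboolP; rewrite BA.
exists (fun b => s2val (cid2 (ex_x b))) => [b|C Cb]; first exact: (s2valP' (cid2 (ex_x b))).
have [n Cn] := BC _ Cb.
apply: (@group_bounded_sub _ _ _ (\bigcup_(i in `I_n.+1) A i)) => [_ [b Cb' <-]|].
  exists (ex_minn (ex_n b)); last exact: (s2valP (cid2 (ex_x b))).
  by case: ex_minnP => m _ min_m; rewrite /= ltnS min_m//; apply/asboolP/Cn.
elim: n.+1 => [|m IH]; first by rewrite II0 bigcup_set0; apply: group_bounded_sub (group_bounded1 1).
by rewrite IIS bigcup_setU bigcup_set1; exact: group_boundedU.
Qed.

End Quotients.

(** * The Birkhoff-Kakutani construction *)

Lemma half_expr_lt (R : archiRealFieldType) (e : R) :
  (0 < e)%R -> exists n, (2%:R^-1 ^+ n < e)%R.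
Proof.
move=> e0; exists (Num.bound e^-1%R).
rewrite exprVn invf_plt ?posrE ?exprn_gt0//.
apply: (lt_trans (archi_boundP _)); first by rewrite invr_ge0 ltW.
by rewrite -natrX ltr_nat ltn_expl.
Qed.

Section LeftInvariantContinuity.
Local Open Scope ring_scope.
Local Open Scope group_scope.

Lemma nbhs_mulVg (G : topologicalGroupType) (x : G) (A : set G) :
  nbhs 1 A -> nbhs x [set y | A (x^-1 * y)].
Proof.
rewrite -(mulVg x) => nA.
have: {for (x^-1, x), continuous (fun xy : G * G => xy.1 * xy.2)}.
  exact: mulg_continuous.
move=> /(_ _ nA)[[U V] /= [nU nV] UVA].
apply: filterS nV => y Vy; apply: (UVA (_, _)); split => //=.
exact: nbhs_singleton nU.
Qed.

(** Translated balls about [1] are neighbourhoods at every point, and [d x y] differs from [d s t]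
    by at most [d x s + d y t]. *)
Lemma left_invariant_continuous (R : realType) (G : topologicalGroupType)
    (d : G -> G -> R) :
  is_pseudometric d -> (forall g x y, d (g * x) (g * y) = d x y) ->
  (forall e : R, 0 < e -> nbhs 1 [set x | d 1 x < e]) ->
  continuous_left_invariant_pseudometric d.
Proof.
move=> dP dL d1; split=> // -[x y]; have [_ _ dC dT] := dP.
have d_nbhs z (e : R) : 0 < e -> nbhs z [set t | d z t < e].
  move=> e0; apply: filterS (nbhs_mulVg z (d1 e e0)) => t /=.
  by rewrite -(dL z) mulg1 mulgA mulgV mul1g.
apply/cvgrPdist_lt => e e0; have e20 : 0 < (e / 2%:R)%R by rewrite divr_gt0.
exists ([set t | d x t < (e / 2%:R)%R], [set t | d y t < (e / 2%:R)%R]).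
  by split; exact: d_nbhs.
move=> [s t] [/= xs yt]; rewrite ltr_norml.
have := dT s x t; have := dT x y t; have := dT x s y; have := dT s t y.
rewrite (dC s x) (dC t y) => ? ? ? ?; apply/andP; split; lra.
Qed.

End LeftInvariantContinuity.

Section BirkhoffKakutani.
Variables (R : realType) (G : topologicalGroupType) (V : int -> set G).
Local Open Scope ring_scope.
Local Open Scope group_scope.
Local Notation pow := (exprz (2%:R : R)).
Hypotheses (V_1 : forall k, V k 1)
  (V_V : forall k x, V k x -> V k x^-1)
  (V_M : forall k x y z, V k x -> V k y -> V k z -> V (k + 1) (x * y * z))
  (V_nbhs : forall k, nbhs 1 (V k))
  (V_cover : forall x, exists k, V k x).

(** Words are factorisations whose letters carry an index [k], a letter from [V k] costing [2 ^ k].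
    The norm [len] below is the infimum of the costs of all factorisations. *)
Let val (w : seq (G * int)) : G := \prod_(p <- w) p.1.
Let cost (w : seq (G * int)) : R := (\sum_(p <- w) pow p.2)%R.
Let word (w : seq (G * int)) := forall p, p \in w -> V p.2 p.1.

Let pow_gt0 k : 0 < pow k. Proof. exact: exprz_gt0. Qed.

Let powD1 k : pow (k + 1) = (pow k + pow k)%R.
Proof. by rewrite exprzDr ?unitfE// expr1z; lra. Qed.

Let cost_ge0 w : 0 <= cost w.
Proof. by apply: sumr_ge0 => p _; exact: ltW. Qed.

Let cost_cat w1 w2 : cost (w1 ++ w2) = (cost w1 + cost w2)%R.
Proof. exact: big_cat. Qed.

Let cost_cons p w : cost (p :: w) = (pow p.2 + cost w)%R.
Proof. exact: big_cons. Qed.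

Let V_le k l : k <= l -> V k `<=` V l.
Proof.
move=> kl x; have [n ->] : exists n : nat, l = (k + n%:Z)%R.
  by exists `|l - k|%N; rewrite gez0_abs ?subr_ge0// addrCA subrr addr0.
elim: n => [|n IH] Vx; first by rewrite addr0.
rewrite -addn1 PoszD addrA -[x]mulg1 -[x]mulg1.
by apply: V_M => //; exact: IH.
Qed.

Let split_word w t : 0 <= t -> t < cost w ->
  exists w1 p w2, [/\ w = w1 ++ p :: w2, cost w1 <= t & t < cost (rcons w1 p)].
Proof.
elim: w t => [|p w IH] t t0; first by rewrite /cost big_nil ltNge t0.
rewrite cost_cons => tw; have [tp|pt] := ltP t (pow p.2).
  by exists [::], p, w; split; rewrite /cost /= ?big_nil ?big_seq1.
have [| |w1 [p' [w2 [-> w1t tw1]]]] := IH (t - pow p.2)%R; [lra|lra|].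
by exists (p :: w1), p', w2; split=> //=; rewrite cost_cons; lra.
Qed.

(* Frink's argument: split the word at the letter where half of its cost is
   reached; both sides then cost at most half, and the middle letter lies in
   [V (k - 1)]. *)
Let word_val_in w k : word w -> cost w < pow k -> V k (val w).
Proof.
have [n] := ubnP (size w); elim: n => // n IH in w k *; rewrite ltnS => wn wV wk.
have [->|w0] := eqVneq w [::]; first by rewrite /val big_nil.
have cw0 : 0 < cost w.
  case: w w0 {wn wV wk} => // p w _; rewrite cost_cons.
  by have := cost_ge0 w; have := pow_gt0 p.2; lra.
have powk : pow k = (pow (k - 1) + pow (k - 1))%R by rewrite -powD1 subrK.
have half0 : 0 <= (cost w / 2%:R)%R by lra.
have half_lt : (cost w / 2%:R)%R < cost w by lra.
have [w1 [p [w2 [wE w1t tw1]]]] := split_word half0 half_lt.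
move: wn wk w1t tw1; rewrite wE size_cat /= addnS => wn.
rewrite -cats1 !cost_cat cost_cons [cost [:: p]]cost_cons.
rewrite [cost [::]]big_nil => wk w1t tw1.
have [[cw1 cw2] cp] := (cost_ge0 w1, cost_ge0 w2, pow_gt0 p.2).
rewrite /val big_cat /= big_cons mulgA -[k](subrK 1%R); apply: V_M.
- apply: IH; first by apply: leq_trans wn; rewrite ltnS leq_addr.
    by move=> r rw; apply: wV; rewrite wE mem_cat rw.
  by lra.
- apply: (@V_le p.2); last by apply: wV; rewrite wE mem_cat inE eqxx orbT.
  have : pow p.2 < pow k by lra.
  by rewrite ltr_eXz2l ?ltr1n// => pk; rewrite lerBrDr lezD1.
(* The word up to and including [p] costs more than half, so [w2] costs less than half. *)
- apply: IH; first by apply: leq_trans wn; rewrite ltnS leq_addl.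
    by move=> r rw; apply: wV; rewrite wE mem_cat inE rw !orbT.
  by lra.
Qed.

Let costs x := [set cost w | w in [set w | word w /\ val w = x]].
Let len x := inf (costs x).

Let costs_lb x : has_lbound (costs x).
Proof. by exists 0%R => _ [w _ <-]. Qed.

Let costs_letter x k : V k x -> costs x (pow k).
Proof.
move=> Vx; exists [:: (x, k)]; last by rewrite /cost big_seq1.
by split; [move=> p; rewrite inE => /eqP->|rewrite /val big_seq1].
Qed.

Let costs_neq0 x : costs x !=set0.
Proof. by have [k /costs_letter] := V_cover x; exists (pow k). Qed.

Let len_le_cost w : word w -> len (val w) <= cost w.
Proof. by move=> wV; apply: ge_inf => //; exists w. Qed.

Let len_lt x r : len x < r -> exists w, [/\ word w, val w = x & cost w < r].
Proof. by move=> /(inf_lt (costs_neq0 x))[_ [w [wV wx] <-] wr]; exists w. Qed.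

Let len_ge0 x : 0 <= len x.
Proof. by apply: lb_le_inf => // _ [w _ <-]. Qed.

Let len1 : len 1 = 0%R.
Proof.
apply/eqP; rewrite eq_le len_ge0 andbT.
have : word [::] by [].
by move=> /len_le_cost; rewrite /val /cost !big_nil.
Qed.

Let lenM x y : len (x * y) <= len x + len y.
Proof.
apply/ler_addgt0Pr => e e0; have e20 : 0 < (e / 2%:R)%R by rewrite divr_gt0.
have [|w [wV <- wx]] := @len_lt x (len x + e / 2%:R)%R; first by lra.
have [|w' [wV' <- wy]] := @len_lt y (len y + e / 2%:R)%R; first by lra.
rewrite [val w * val w'](_ : _ = val (w ++ w')); last by rewrite /val big_cat.
apply: le_trans (len_le_cost _) _; last by rewrite cost_cat; lra.
by move=> p; rewrite mem_cat => /orP[/wV|/wV'].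
Qed.

Let lenV_le x : len x^-1 <= len x.
Proof.
apply/ler_addgt0Pr => e e0.
have [|w [wV <- wx]] := @len_lt x (len x + e)%R; first by lra.
pose w' := rev [seq (p.1^-1, p.2) | p <- w].
have -> : (val w)^-1 = val w'.
  rewrite /val /w'; elim: w {wV wx w'} => [|p w IH]; first by rewrite !big_nil invg1.
  by rewrite big_cons invgM IH /= rev_cons -cats1 big_cat /= big_seq1.
apply: (@le_trans _ _ (cost w')); last first.
  suff -> : cost w' = cost w by exact: ltW.
  by rewrite /cost /w' (perm_big _ (permEl (perm_rev _))) /= big_map.
apply: len_le_cost => p; rewrite mem_rev => /mapP[p' /wV Vp' ->] /=.
exact: V_V.
Qed.

Let lenV x : len x^-1 = len x.
Proof. by apply/eqP; rewrite eq_le lenV_le /= -{1}[x]invgK lenV_le. Qed.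

(** The distance is [len (x^-1 * y)]. It is continuous because an element of [V (- n)] is a single
    letter of cost [2 ^ (- n)], and Frink's splitting puts its balls inside the [V k]. *)
Lemma birkhoff_kakutani : exists2 d : G -> G -> R,
  continuous_left_invariant_pseudometric d &
  forall k x, d 1 x < pow k -> V k x.
Proof.
exists (fun x y => len (x^-1 * y)); last first.
  by move=> k x; rewrite invg1 mul1g => /len_lt[w [wV <- /word_val_in]]; apply.
apply: left_invariant_continuous.
- split=> [x y|x|x y|x y z]; [exact: len_ge0|by rewrite mulVg|..].
    by rewrite -lenV invgM invgK.
  by rewrite -[x^-1 * z](_ : x^-1 * y * (y^-1 * z) = _) ?lenM// mulgA mulgK.
- by move=> g x y; rewrite invgM mulgA mulgVK.
- move=> e /half_expr_lt[n]; rewrite exprnP exprz_inv => ne; apply: filterS (V_nbhs (- n%:Z)%R) => x Vx /=.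
  by apply: le_lt_trans ne; rewrite invg1 mul1g; apply: ge_inf => //; exact: costs_letter.
Qed.

End BirkhoffKakutani.

(** * Baire category *)

Section Meagre.
Context {T : topologicalType}.
Implicit Types (S M Y : set T).

(** Encoded by dense open sets rather than by nowhere dense ones, to match [baire_space]. *)
Definition meagre M := exists U : nat -> set T,
  (forall n, open (U n) /\ dense (U n)) /\ M `&` \bigcap_n U n = set0.

Definition baire_space := forall U : nat -> set T,
  (forall n, open (U n) /\ dense (U n)) -> dense (\bigcap_n U n).

Lemma meagre_sub S M : S `<=` M -> meagre M -> meagre S.
Proof.
move=> SM [U [Uod MU]]; exists U; split=> //.
by apply/seteqP; split=> // x [/SM Mx Ux]; rewrite -MU.
Qed.

Lemma meagre_bigcup (F : nat -> set T) :
  (forall n, meagre (F n)) -> meagre (\bigcup_n F n).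
Proof.
move=> /choice[U FU].
(* Pairs are enumerated by [pickle]; a number coding no pair gets the whole space, which is open and
   dense. *)
exists (fun k => if unpickle k is Some (n, m) then U n m else setT); split.
  move=> k; case: unpickle => [[n m]|]; first exact: (FU n).1.
  by split; [exact: openT|move=> Y O0 _; rewrite setIT].
apply/seteqP; split=> // x [[n _ Fx] Ux].
rewrite -(FU n).2; split=> // m _.
by have := Ux (pickle (n, m)) I; rewrite pickleK.
Qed.

Lemma meagre_setC_open_dense U : open U -> dense U -> meagre (~` U).
Proof.
move=> Uo Ud; exists (fun=> U); split=> //.
by apply/seteqP; split=> // x [nUx /(_ 0 I)].
Qed.

Lemma meagreU S M : meagre S -> meagre M -> meagre (S `|` M).
Proof.
move=> Sm Mm; apply: (meagre_sub (M := \bigcup_n if n is 0 then S else M)).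
  by move=> x [Sx|Mx]; [exists 0|exists 1].
by apply: meagre_bigcup => -[].
Qed.

Lemma meagre0 : meagre set0.
Proof.
by rewrite -setCT; apply: meagre_setC_open_dense; [exact: openT|move=> Y O0 _; rewrite setIT].
Qed.

Lemma baire_not_meagre Y : baire_space -> open Y -> Y !=set0 -> ~ meagre Y.
Proof.
move=> Tb Oo O0 [U [/Tb/(_ Y O0 Oo)[x OUx] OU]].
by rewrite -[False]/(set0 x) -OU.
Qed.

(* The largest open set in which [S] is nowhere meagre. *)
Definition nonmeagre_locus S := \bigcup_(Y in [set Y | open Y /\
  forall P, open P -> P !=set0 -> P `<=` Y -> ~ meagre (S `&` P)]) Y.

Lemma nonmeagre_locus_open S : open (nonmeagre_locus S).
Proof. by apply: bigcup_open => Y []. Qed.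

Lemma nonmeagre_locus_closure S : nonmeagre_locus S `<=` closure S.
Proof.
move=> x [Y [Oo OS] Ox] N /=; rewrite nbhsE => -[P [Po Px] PN].
have [y [Sy [Py _]]] : (S `&` (P `&` Y)) !=set0.
  apply/set0P/eqP => SP0; apply: (OS (P `&` Y)) => [|||].
  - exact: openI.
  - by exists x.
  - exact: subIsetr.
  - by rewrite SP0; exact: meagre0.
by exists y; split=> //; exact: PN.
Qed.

Variable N : nat -> set T.
Hypotheses (N_open : forall n, open (N n))
  (N_basis : forall Y x, open Y -> Y x -> exists2 n, N n x & N n `<=` Y).

(* Banach category theorem. *)
Lemma nonmeagre_locus_meets S Y :
  open Y -> ~ meagre (S `&` Y) -> (Y `&` nonmeagre_locus S) !=set0.
Proof.
move=> Oo SO; apply: contrapT => /set0P/negP/negPn/eqP OS0; apply: SO.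
(* [W] gathers the basic open sets in which [S] is meagre; with the exterior of [Y] it is dense,
   because the locus of [S] misses [Y]. *)
pose J := [set n | meagre (S `&` N n)].
pose W := \bigcup_(n in J) N n.
have Wo : open (W `|` (~` Y)°).
  by apply: openU; [apply: bigcup_open => n _|exact: open_interior].
have Wd : dense (W `|` (~` Y)°).
  move=> Q [x Qx] Qo.
  have [QO0|/set0P[y [Qy Oy]]] := eqVneq (Q `&` Y) set0.
    exists x; split=> //; right; rewrite /interior /= nbhsE; exists Q => // z Qz Oz.
    by rewrite -[False]/(set0 z) -QO0.
  have [P [Po [z Pz] PQY SP]] : exists P,
      [/\ open P, P !=set0, P `<=` Q `&` Y & meagre (S `&` P)].
    apply: contrapT => noP; rewrite -[False]/(set0 y) -OS0; split=> //.
    exists (Q `&` Y) => //; split=> [|P Po P0 PQY SP]; first exact: openI.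
    by apply: noP; exists P.
  have [n Nz NP] := N_basis Po Pz.
  exists z; split; first by have [] := PQY z Pz.
  left; exists n => //; apply: meagre_sub SP; exact: setIS.
apply: (meagre_sub (M := ~` (W `|` (~` Y)°) `|` \bigcup_n (if pselect (J n) then S `&` N n else set0))).
  move=> x [Sx Ox]; have [[n Jn Nx]|nWx] := pselect (W x).
    by right; exists n => //; case: pselect.
  by left => -[//|/interior_subset].
apply: meagreU; first exact: meagre_setC_open_dense.
by apply: meagre_bigcup => n; case: pselect => [Jn|nJ] /=; [exact: Jn|exact: meagre0].
Qed.

(** The loci of the [F n] and the exterior of that of [S] form a dense open set: in a nonempty open
    set where [S] is nowhere meagre some [F n] is non-meagre, and the locus of that [F n] meets
    it. *)
Lemma nonmeagre_locus_bigcup S (F : nat -> set T) :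
  S `<=` \bigcup_n F n ->
  meagre (nonmeagre_locus S `\` \bigcup_n nonmeagre_locus (F n)).
Proof.
move=> SF; pose W := \bigcup_n nonmeagre_locus (F n).
pose E := (~` nonmeagre_locus S)°.
have Wo : open (W `|` E).
  by apply: openU; [apply: bigcup_open => n _; exact: nonmeagre_locus_open|exact: open_interior].
apply: (meagre_sub (M := ~` (W `|` E))).
  by move=> x [Sx nWx] [//|/interior_subset].
apply: meagre_setC_open_dense => // Q [x Qx] Qo.
have [QS0|/set0P[y [Qy [Y [Oo OS] Oy]]]] := eqVneq (Q `&` nonmeagre_locus S) set0.
  exists x; split=> //; right; rewrite /E /interior /= nbhsE; exists Q => // z Qz Sz.
  by rewrite -[False]/(set0 z) -QS0.
have QOo : open (Q `&` Y) by exact: openI.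
have [n Fn] : exists n, ~ meagre (F n `&` (Q `&` Y)).
  apply: contrapT => /forallNP Fm.
  have QY0 : (Q `&` Y) !=set0 by exists y.
  apply: (OS _ QOo QY0); first exact: subIsetr.
  apply: (meagre_sub (M := \bigcup_n (F n `&` (Q `&` Y)))).
    by rewrite -setI_bigcupl; exact: setSI.
  by apply: meagre_bigcup => n; exact: contrapT.
have [z [[Qz _] Fz]] := nonmeagre_locus_meets QOo Fn.
by exists z; split=> //; left; exists n.
Qed.

Lemma nonmeagre_locus_cover (F : nat -> set T) : baire_space ->
  [set: T] !=set0 -> \bigcup_n F n = setT ->
  exists n, nonmeagre_locus (F n) !=set0.
Proof.
move=> Tb T0 FT; apply: contrapT => /forallNP F0.
apply: (baire_not_meagre Tb openT T0); rewrite -FT.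
apply: meagre_bigcup => n; apply: contrapT; rewrite -[F n]setIT.
by move=> /(nonmeagre_locus_meets openT)[x [_ Fx]]; apply: (F0 n); exists x.
Qed.

End Meagre.
Arguments baire_space : clear implicits.

(** * Baire's theorem and countable bases for Polish spaces *)

Section PolishSpace.
Context {R : realType} {T : topologicalType} {d : T -> T -> R}.
Hypotheses (d_metric : is_metric d) (d_top : metric_induces_topology d)
  (d_complete : metric_complete d).
Local Open Scope ring_scope.

Lemma metric_nbhsP x (A : set T) :
  nbhs x A <-> exists2 e, 0 < e & forall y, d x y < e -> A y.
Proof. by rewrite d_top; split=> -[e e0 eA]; exists e. Qed.

Lemma metric_ball_open x r : open [set y | d x y < r].
Proof.
rewrite openE => y /= xyr; apply/metric_nbhsP; exists (r - d x y); first by lra.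
move=> z yz; have [[_ _ _ dT] _] := d_metric.
by have := dT x y z; rewrite /=; lra.
Qed.

Lemma metric_baire : baire_space T.
Proof.
have [[d0 dxx dC dT] _] := d_metric.
move=> U Uod Y [x0 Ox0] Oo.
have [r0 r00 r0O] : exists2 e, 0 < e & forall y, d x0 y < e -> Y y.
  exact/metric_nbhsP/open_nbhs_nbhs.
(* A state holds a step number, a centre and a radius. The guard [0 < s.2.2] makes [next] total, as
   dependent choice demands. *)
pose next (s s' : nat * (T * R)) := s'.1 = s.1.+1 /\ (0 < s.2.2 ->
  [/\ 0 < s'.2.2, s'.2.2 <= s.2.2 / 2%:R &
      forall y, d s'.2.1 y <= s'.2.2 -> d s.2.1 y < s.2.2 /\ U s.1 y]).
have nextP s : {s' | next s s'}.
  apply: cid; case: s => n [x r]; have [r_gt0|r_le0] := ltP 0 r; last first.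
    by exists (n.+1, (x, r)); split=> //=; rewrite ltNge r_le0.
  have [Uo Ud] := Uod n.
  have [|z [/= xz Uz]] := Ud [set y | d x y < r] _ (@metric_ball_open x r).
    by exists x; rewrite /= dxx.
  have /metric_nbhsP[e e0 eU] : nbhs z ([set y | d x y < r] `&` U n).
    by apply: open_nbhs_nbhs; split; [apply: openI => //; exact: metric_ball_open|].
  (* [e / 2] puts the new closed ball inside the open ball of radius [e]; [r / 2] sends the radii to
     0. *)
  exists (n.+1, (z, Num.min (e / 2%:R) (r / 2%:R))); split=> //= _; split.
  - by rewrite lt_min !divr_gt0.
  - by rewrite ge_min lexx orbT.
  - by move=> y; rewrite le_min => /andP[zy _]; apply: eU; lra.
have [f [f0 fS]] := dependent_choice nextP (0%N, (x0, r0)).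
pose x n := (f n).2.1; pose r n := (f n).2.2.
have fst_f n : (f n).1 = n by elim: n => [|n IH]; [rewrite f0|rewrite (fS n).1 IH].
have r_gt0 n : 0 < r n by elim: n => [|n IH]; [rewrite /r f0|have [_ /(_ IH)[]] := fS n].
have stepP n : r n.+1 <= r n / 2%:R /\
    forall y, d (x n.+1) y <= r n.+1 -> d (x n) y < r n /\ U n y.
  have [_ /(_ (r_gt0 n))[_ rn xU]] := fS n; split=> // y /xU.
  by rewrite fst_f.
have nested m n : (n <= m)%N -> forall y, d (x m) y < r m -> d (x n) y < r n.
  move=> /subnK <-; elim: (m - n)%N => [//|k IH] y.
  by rewrite addSn => /ltW/(stepP (k + n)%N).2[/IH].
have close m n : (n <= m)%N -> d (x n) (x m) < r n.
  by move=> nm; apply: nested nm _ _; rewrite dxx.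
have r_small n : r n <= r0 * 2%:R^-1 ^+ n.
  elim: n => [|n IH]; first by rewrite expr0 mulr1 /r f0.
  by apply: le_trans (stepP n).1 _; rewrite exprSr mulrA ler_pM2r// invr_gt0.
have [l xl] : exists l, forall e, 0 < e ->
    exists N, forall n, (N <= n)%N -> d (x n) l < e.
  apply: d_complete => e e0.
  (* Two terms past [N] are both within [r N <= r0 / 2 ^ N] of [x N]. *)
  have [|N Ne] := @half_expr_lt R (e / (r0 + r0)); first by rewrite divr_gt0// addr_gt0.
  exists N => m n Nm Nn; apply: le_lt_trans (dT _ (x N) _) _.
  have := close _ _ Nm; have := close _ _ Nn; rewrite (dC (x m)) => ? ?.
  have := r_small N; move: Ne; rewrite ltr_pdivlMr ?addr_gt0//.
  by rewrite [_ * (_ + _)]mulrC mulrDl; lra.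
have x_l n : d (x n) l <= r n.
  apply/ler_addgt0Pr => e /xl[N xN]; apply: le_trans (dT _ (x (maxn N n)) _) _.
  have := close _ _ (leq_maxr N n); have := xN _ (leq_maxl N n); lra.
(* Lying in the closed ball of step [n.+1], [l] lies in the open ball and in the dense set of step
   [n]. *)
exists l; split.
  apply: r0O; have := (stepP 0%N).2 l (x_l 1%N).
  by rewrite /x /r f0 => -[].
by move=> n _; have [] := (stepP n).2 l (x_l n.+1).
Qed.

Hypothesis T_separable : separable_space T.

Lemma separable_sequence : [set: T] !=set0 ->
  exists u : nat -> T, forall y e, 0 < e -> exists n, d (u n) y < e.
Proof.
move=> [t _]; have [D /pfcard_geP Dc Dd] := T_separable.
case: Dc => [D0|/unsquash u].
  by have [|x []] := Dd setT _ openT; [exists t|rewrite D0].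
exists u => y e e0.
have [|x [/= yx Dx]] := Dd [set x | d y x < e] _ (@metric_ball_open y e).
  by exists y; rewrite /=; have [[_ -> _ _] _] := d_metric.
have [n _ unx] := @surj _ _ _ _ u _ Dx; exists n; rewrite unx.
by have [[_ _ -> _] _] := d_metric.
Qed.

Lemma metric_basis : [set: T] !=set0 -> exists N : nat -> set T,
  (forall n, open (N n)) /\
  forall Y x, open Y -> Y x -> exists2 n, N n x & N n `<=` Y.
Proof.
move=> /separable_sequence[u uP]; have [[d0 dxx dC dT] _] := d_metric.
exists (fun k => if unpickle k is Some (n, m) then [set y | d (u n) y < 2%:R^-1 ^+ m]
  else setT); split.
  by move=> k; case: unpickle => [[n m]|]; [exact: metric_ball_open|exact: openT].
move=> Y x Oo Ox; have /metric_nbhsP[e e0 eO] : nbhs x Y by apply: open_nbhs_nbhs.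
have [|m me] := @half_expr_lt R (e / 2%:R); first by rewrite divr_gt0.
have [|n nx] := uP x (2%:R^-1 ^+ m); first by rewrite exprn_gt0// invr_gt0.
exists (pickle (n, m)); rewrite pickleK//= => y /= ny; apply: eO.
by have := dT x (u n) y; rewrite (dC x (u n)); lra.
Qed.

End PolishSpace.

(** * Cosets in Polish groups *)

Section Translations.
Variable G : topologicalGroupType.
Local Open Scope group_scope.

Lemma mulgl_continuous (h : G) : continuous (fun x : G => h * x).
Proof.
move=> x; apply: (@continuous_comp _ _ _ (fun x => (h, x)) (fun xy : G * G => xy.1 * xy.2)).
  by apply: cvg_pair; [exact: cvg_cst|exact: cvg_id].
exact: mulg_continuous.
Qed.

Lemma mulgr_continuous (h : G) : continuous (fun x : G => x * h).
Proof.
move=> x; apply: (@continuous_comp _ _ _ (fun x => (x, h)) (fun xy : G * G => xy.1 * xy.2)).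
  by apply: cvg_pair; [exact: cvg_id|exact: cvg_cst].
exact: mulg_continuous.
Qed.

Lemma open_mulgl (h : G) (U : set G) : open U -> open [set x | U (h * x)].
Proof.
move=> Uo; apply: (open_comp (f := fun x => h * x) (D := U)) => // x _.
exact: mulgl_continuous.
Qed.

End Translations.

Section SaturatedSets.
Context {R : realType} {G : topologicalGroupType}.
Variables (H : normalSubgroup G) (d : G -> G -> R).
Hypotheses (G_separable : separable_space G) (d_metric : is_metric d)
  (d_top : metric_induces_topology d) (d_complete : metric_complete d)
  (H_closed : closed [set` H]).
Local Open Scope ring_scope.
Local Open Scope group_scope.
Local Notation q := (quotient_map H).

Let d_refl x : d x x = 0. Proof. by have [[]] := d_metric. Qed.
Let dC x y : d x y = d y x. Proof. by have [[]] := d_metric. Qed.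
Let dT x y z : d x z <= d x y + d y z. Proof. by have [[]] := d_metric. Qed.

Let G_neq0 : [set: G] !=set0. Proof. by exists 1. Qed.

(** This is the product [S H]; using it keeps the category arguments inside the Polish group [G]. *)
Definition saturation (S : set G) := q @^-1` (q @` S).

Lemma saturation_bigcup (F : nat -> set G) :
  saturation (\bigcup_n F n) = \bigcup_n saturation (F n).
Proof. by rewrite /saturation image_bigcup preimage_bigcup. Qed.

(** The elements [s^-1 * y] of [H] come arbitrarily close to [l^-1 * x], and [H] is closed. *)
Lemma closed_coset_limit x l :
  (forall P X, nbhs l P -> nbhs x X -> exists s y, [/\ P s, X y & q s = q y]) ->
  q l = q x.
Proof.
move=> lx; apply/quotient_map_eq; move/closure_id: H_closed => clH.
suff : closure [set` H] (l^-1 * x) by rewrite -clH.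
move=> W /= nW.
have [[U X] /= [nU nX] UXW] := mulg_continuous (l^-1, x) W nW.
have [s [y [Us Xy /quotient_map_eq sy]]] := lx _ _ (invg_continuous l U nU) nX.
by exists (s^-1 * y); split=> //; exact: (UXW (s^-1, y)).
Qed.

Section Scheme.
Variables (u : nat -> G) (A : set G).
Hypothesis u_dense : forall y (e : R), 0 < e -> exists n, d (u n) y < e.
Local Notation r n := ((2%:R^-1 : R) ^+ n)%R.

Let r_gt0 n : 0 < r n. Proof. by rewrite exprn_gt0// invr_gt0. Qed.

(* A Souslin scheme for [A] indexed by finite sequences, read backwards. *)
Fixpoint piece (s : seq nat) : set G :=
  if s is k :: s' then piece s' `&` [set y | d (u k) y < r (size s')] else A.

Lemma piece_split s : piece s = \bigcup_k piece (k :: s).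
Proof.
apply/seteqP; split=> [y sy|y [k _ []//]].
by have [k ky] := u_dense y (r_gt0 (size s)); exists k.
Qed.

Local Notation in_locus x s := (nonmeagre_locus (saturation (piece s)) x).

(** Follow a branch along which [x] stays in the locus. Its pieces shrink to a point [l] of the
    closure of [A], and [x] is adherent to the saturation of each of them, so [l] and [x] share a
    coset. *)
Lemma scheme_branch x : in_locus x [::] ->
  (forall s, in_locus x s -> exists k, in_locus x (k :: s)) ->
  saturation (closure A) x.
Proof.
move=> x0 xS.
pose next (s s' : {s | in_locus x s}) := exists k, sval s' = k :: sval s.
have nextP s : {s' | next s s'}.
  apply: cid; case: s => s xs; have [k xks] := xS s xs.
  by exists (exist _ (k :: s) xks), k.
have [f [f0 fS]] := dependent_choice nextP (exist _ [::] x0).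
pose p n := piece (sval (f n)).
have sz n : size (sval (f n)) = n.
  elim: n => [|n IH]; first by rewrite f0.
  by have [k ->] := fS n; rewrite /= IH.
have p_nested m n : (n <= m)%N -> p m `<=` p n.
  move=> /subnK <-; elim: (m - n)%N => [//|k IH] y.
  by rewrite addSn /p; have [j ->] := fS (k + n)%N => -[/IH].
have pA m : p m `<=` A by move=> y /(p_nested m 0 (leq0n m)); rewrite /p f0.
(* The piece of stage [n.+1] lies within [r n] of a single [u j]. *)
have p_diam n y z : p n.+1 y -> p n.+1 z -> d y z < (r n + r n)%R.
  rewrite /p; have [j ->] := fS n => -[_ /=]; rewrite sz => uy [_ /= uz].
  by have := dT y (u j) z; rewrite (dC y (u j)); lra.
have p_closure n : closure (saturation (p n)) x.
  exact/nonmeagre_locus_closure/(svalP (f n)).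
have /choice[a pa] n : exists a, p n a.
  by have [y [[a pa _] _]] := p_closure n setT filterT; exists a.
have small (e : R) : 0 < e -> exists n, (r n + r n)%R < e.
  by move=> e0; have [|n ne] := @half_expr_lt R (e / 2%:R)%R; [lra|exists n; lra].
have [l al] : exists l, forall e, 0 < e ->
    exists N, forall n, (N <= n)%N -> d (a n) l < e.
  apply: d_complete => e /small[N Ne]; exists N.+1 => m n Nm Nn.
  by apply: lt_trans Ne; apply: p_diam; exact: p_nested (pa _).
exists l.
  move=> W /= /(metric_nbhsP d_top)[e e0 eW]; have [N aN] := al e e0.
  by exists (a N); split; [exact: pA (pa N)|apply: eW; rewrite dC; exact: aN].
apply: closed_coset_limit => W X /(metric_nbhsP d_top)[e e0 eW] nX.
have e20 : (0 < e / 2%:R)%R by lra.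
have [[n ne] [N aN]] := (small _ e20, al _ e20).
have [y [[s ps sy] Xy]] := p_closure (maxn N n).+1 X nX.
exists s, y; split=> //; apply: eW.
have := aN _ (leqW (leq_maxl N n)).
have : d (a (maxn N n).+1) s < (r n + r n)%R.
  by apply: p_diam; apply: (p_nested (maxn N n).+1) => //; rewrite ltnS leq_maxr.
by have := dT l (a (maxn N n).+1) s; rewrite (dC l (a _)); lra.
Qed.

End Scheme.

(* Plays the role of the Baire property of the analytic set [q @` A]. *)
Lemma saturation_closure_comeagre (A : set G) :
  meagre (nonmeagre_locus (saturation A) `\` saturation (closure A)).
Proof.
have [N [N_open N_basis]] := metric_basis d_metric d_top G_separable G_neq0.
have [u u_dense] := separable_sequence d_metric d_top G_separable G_neq0.
pose L s := nonmeagre_locus (saturation (piece u A s)).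
(* [M s] holds the points at which no branch continues past [s]; off all of them [scheme_branch]
   applies. Numbers coding no sequence fall back on the root. *)
pose M s := L s `\` \bigcup_k L (k :: s).
apply: (meagre_sub (M := \bigcup_n M (odflt [::] (unpickle n)))).
  move=> x [x0 nx]; apply: contrapT => nMx; apply: nx.
  apply: (scheme_branch (u := u) (A := A)) => // s xs; apply: contrapT => /forallNP xsk.
  apply: nMx; exists (pickle s) => //; rewrite pickleK; split=> // -[k _].
  exact: xsk.
apply: meagre_bigcup => n.
apply: (nonmeagre_locus_bigcup N_open N_basis).
by rewrite -saturation_bigcup -piece_split.
Qed.

Lemma meagre_translate (g : G) (M : set G) :
  meagre M -> meagre [set x | M (g * x)].
Proof.
move=> [U [Uod MU]]; exists (fun n => [set x | U n (g * x)]); split.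
  move=> n; have [Uo Ud] := Uod n; split; first exact: open_mulgl.
  move=> Q [x Qx] Qo; have [|y [Qy Uy]] := Ud [set y | Q (g^-1 * y)] _ (open_mulgl g^-1 Qo).
    by exists (g * x); rewrite /= mulKg.
  by exists (g^-1 * y); split=> //=; rewrite mulVKg.
apply/seteqP; split=> // x [/= Mx Ux]; rewrite -[False]/(set0 (g * x)) -MU.
by split=> // n _; exact: Ux.
Qed.

(* Pettis' argument: if [g * L] meets the open set [L] in which the saturation
   is comeagre, some point lies in both [saturation A] and its translate. *)
Lemma saturation_pettis (A : set G) :
  nonmeagre_locus (saturation A) !=set0 ->
  nbhs 1 (saturation [set a * b^-1 | a in closure A & b in closure A]).
Proof.
set L := nonmeagre_locus _ => -[x0 Lx0].
have Lo : open L := nonmeagre_locus_open (saturation A).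
have : nbhs 1 [set g | L (g * x0)].
  have := @mulgr_continuous _ x0 1 L; rewrite mul1g; apply.
  exact: open_nbhs_nbhs.
apply: filterS => g /= Lgx0.
have Lgo : open (L `&` [set x | L (g^-1 * x)]).
  by apply: openI => //; exact: open_mulgl.
have Lm := @saturation_closure_comeagre A.
have G_baire := metric_baire d_metric d_top d_complete.
have : ~ meagre (L `&` [set x | L (g^-1 * x)]).
  by apply: baire_not_meagre => //; exists (g * x0); split=> //=; rewrite mulKg.
apply: contra_notP => ng.
(* If [g] were outside, then for every [x] in the intersection either [x] or [g^-1 * x] would escape
   the saturation of the closure, and each case is meagre. *)
apply: meagre_sub (meagreU Lm (meagre_translate g^-1 Lm)).
move=> x [Lx Lgx].
have [[a Aa ax]|nx] := pselect (saturation (closure A) x); last by left.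
right; split=> // -[b Ab bx]; apply: ng; exists (a * b^-1).
  by exists a => //; exists b.
by rewrite quotient_mapM quotient_mapV ax bx -quotient_mapV -quotient_mapM invgM invgK mulVKg.
Qed.

End SaturatedSets.

(** * The two-sided chain and its pseudometric *)

Section CoarseChain.
Context {G : topologicalGroupType}.
Local Open Scope ring_scope.
Local Open Scope group_scope.

Definition cube (A : set G) := [set x | exists a b c, [/\ A a, A b, A c & x = a * b * c]].

(** Take square roots twice, products from [W] being in [A] and those from [W'] in [W], then
    intersect and symmetrise. *)
Lemma nbhs1_cube_root (A : set G) : nbhs 1 A ->
  exists U : set G, [/\ nbhs 1 U, forall x, U x -> U x^-1 & cube U `<=` A].
Proof.
have root (B : set G) : nbhs 1 B -> exists2 U : set G, nbhs 1 U &
    forall x y, U x -> U y -> B (x * y).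
  rewrite -{1}[1]mulg1 => nB; have [[U W] /= [nU nW] UW] := mulg_continuous (1, 1) B nB.
  exists (U `&` W); first exact: filterI.
  by move=> x y [Ux _] [_ Wy]; exact: (UW (x, y)).
move=> /root[W nW WA]; have [W' nW' W'W] := root W nW.
pose S := W `&` W'.
have nS : nbhs 1 S by exact: filterI.
have nSV : nbhs 1 [set x | S x^-1] by apply: (invg_continuous 1); rewrite invg1.
exists (S `&` [set x | S x^-1]); split; first exact: filterI.
  by move=> x [Sx Sx']; split=> //=; rewrite invgK.
by move=> _ [x [y [z [[[_ Wx] _] [[_ Wy] _] [[Wz _] _] ->]]]]; apply: WA => //; exact: W'W.
Qed.

Variables (L0 : set G) (B : nat -> set G).
Hypotheses (L0_nbhs : nbhs 1 L0) (L0V : forall x, L0 x -> L0 x^-1)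
  (B_cover : \bigcup_n B n = setT).

(** Cubing gives the product condition [V_M], adjoining [B n'] makes the chain cover [G], and
    inverses keep it symmetric. *)
Fixpoint coarse_chain n : set G :=
  if n is n'.+1 then
    cube (coarse_chain n' `|` (B n' `|` [set x^-1 | x in B n']))
  else L0.

Let chain_1 n : coarse_chain n 1.
Proof.
elim: n => [|n IH]; first exact: nbhs_singleton.
by exists 1, 1, 1; split; rewrite ?mulg1//; left.
Qed.

Let chain_sub n : coarse_chain n `<=` coarse_chain n.+1.
Proof. by move=> x Lx; exists x, 1, 1; split; rewrite ?mulg1//; left. Qed.

Let chainV n x : coarse_chain n x -> coarse_chain n x^-1.
Proof.
elim: n x => [|n IH] x; first exact: L0V.
have V y : (coarse_chain n `|` (B n `|` [set x^-1 | x in B n])) y ->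
    (coarse_chain n `|` (B n `|` [set x^-1 | x in B n])) y^-1.
  move=> [/IH|[By|[z Bz <-]]]; first by left.
    by right; right; exists y.
  by right; left; rewrite invgK.
move=> [a [b [c [/V a' /V b' /V c' ->]]]].
by exists c^-1, b^-1, a^-1; split=> //; rewrite !invgM mulgA.
Qed.

Lemma chain_pseudometric (R : realType) : exists2 d : G -> G -> R,
  continuous_left_invariant_pseudometric d &
  forall n x, d 1 x < (2%:R ^+ n)%R -> coarse_chain n x.
Proof.
have /choice[f fP] (A : set G) : exists U : set G, nbhs 1 A ->
    [/\ nbhs 1 U, forall x, U x -> U x^-1 & cube U `<=` A].
  have [nA|nA] := pselect (nbhs 1 A); last by exists set0.
  by have [U UA] := nbhs1_cube_root nA; exists U.
pose U n := iter n f L0.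
have U_nbhs n : nbhs 1 (U n) by elim: n => // n /fP[].
(* [Negz n] is [- n.+1], hence the shift; the two halves fit since [U 0] and [coarse_chain 0] are
   both [L0]. *)
pose V (k : int) := match k with Posz n => coarse_chain n | Negz n => U n.+1 end.
have V_nbhs k : nbhs 1 (V k).
  case: k => n; last exact: U_nbhs.
  elim: n => // n IH; apply: filterS IH; exact: chain_sub.
have V_1 k : V k 1 by exact: nbhs_singleton.
have VV k x : V k x -> V k x^-1.
  by case: k => n; [exact: chainV|have [_ + _] := fP _ (U_nbhs n); exact].
have VM k x y z : V k x -> V k y -> V k z -> V (k + 1)%R (x * y * z).
  case: k => n Vx Vy Vz.
    rewrite -PoszD addn1; exists x, y, z; split=> //; by left.
  have -> : V (Negz n + 1)%R = U n.
    by rewrite NegzE -addn1 PoszD opprD subrK; case: n {Vx Vy Vz}.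
  by have [_ _ +] := fP _ (U_nbhs n); apply; exists x, y, z.
have V_cover x : exists k, V k x.
  have : [set: G] x by [].
  rewrite -B_cover => -[n _ Bx]; exists n.+1; exists x, 1, 1.
  by split; [right; left|left..|rewrite !mulg1].
have [d dP dV] := birkhoff_kakutani R V_1 VV VM V_nbhs V_cover.
by exists d => // n x xn; exact: (dV n x).
Qed.

Lemma bounded_in_chain (R : realType) (A : set G) :
  group_bounded R A -> exists n, A `<=` coarse_chain n.
Proof.
have [d dP dL] := chain_pseudometric R.
move=> /group_boundedP/(_ d dP)[M MA]; exists (Num.bound `|M|%R) => a /MA aM.
apply: dL; apply: le_lt_trans (le_trans aM (ler_norm M)) _.
apply: lt_trans (archi_boundP _) _; first exact: normr_ge0.
by rewrite -natrX ltr_nat ltn_expl.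
Qed.

End CoarseChain.

(** * Lifting bounded sets when [H] is sigma-cobounded *)

Section SigmaCobounded.
Context {R : realType} {G : topologicalGroupType}.
Variable H : normalSubgroup G.
Local Open Scope ring_scope.
Local Open Scope group_scope.
Local Notation q := (quotient_map H).

Let liftable (B : set (quotient_group H)) :=
  exists2 A : set G, group_bounded R A & B `<=` q @` A.

Let liftableU B C : liftable B -> liftable C -> liftable (B `|` C).
Proof.
move=> [A Ab BA] [A' Ab' CA']; exists (A `|` A'); first exact: group_boundedU.
by rewrite image_setU; exact: setUSS.
Qed.

Let liftableV B : liftable B -> liftable [set x^-1 | x in B].
Proof.
move=> [A Ab BA]; exists [set x^-1 | x in A]; first exact: group_boundedV.
move=> _ [_ /BA[x Ax <-] <-]; rewrite -quotient_mapV.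
by exists x^-1 => //; exists x.
Qed.

Let liftable_cube B : liftable B -> liftable (cube B).
Proof.
move=> [A Ab BA]; exists [set x * y | x in [set x * y | x in A & y in A] & y in A].
  by do ?apply: group_boundedM.
move=> _ [_ [_ [_ [/BA[x Ax <-] /BA[y Ay <-] /BA[z Az <-] ->]]]].
exists (x * y * z); last by rewrite !quotient_mapM.
by exists (x * y); [exists x => //; exists y|exists z].
Qed.

Lemma sigma_cobounded_lifting : polish_space R G -> closed [set` H] ->
  sigma_cobounded R [set` H] -> bounded_lifting (R := R) H.
Proof.
move=> [G_sep [d [d_metric d_top d_complete]]] H_closed [A [Ab AT]].
(* By normality [h * a] lies in the coset of [a]. *)
have A_cover : \bigcup_n saturation H (A n) = setT.
  apply/seteqP; split=> // x _; have : [set: G] x by [].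
  rewrite AT => -[n _ [h Hh [a Aa hx]]]; exists n => //; exists a => //.
  apply/quotient_map_eq; rewrite -hx.
  by have := gpred_conj _ a Hh; rewrite conjgE.
have G_neq0 : [set: G] !=set0 by exists 1.
have [N [N_open N_basis]] := metric_basis d_metric d_top G_sep G_neq0.
have [n An0] := nonmeagre_locus_cover N_open N_basis
  (metric_baire d_metric d_top d_complete) G_neq0 A_cover.
have := saturation_pettis G_sep d_metric d_top d_complete H_closed An0.
set K := [set a * b^-1 | a in _ & b in _] => nK.
(* [K] and its saturation have the same image, and [q] is open. *)
have nqK : nbhs 1 (q @` K).
  apply: (@filterS _ _ _ (q @` (saturation H K)°)).
    by move=> _ [x /interior_subset Kx <-].
  apply: open_nbhs_nbhs; split.
    by apply: quotient_map_open; exact: open_interior.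
  by exists 1; [exact: nK|exact: quotient_map1].
have qKV x : (q @` K) x -> (q @` K) x^-1.
  move=> [_ [a Aa [b Bb <-]] <-]; exists (b * a^-1); first by exists b => //; exists a.
  by rewrite -quotient_mapV invgM invgK.
have Kb : group_bounded R K.
  have -> : K = [set a * b | a in closure (A n) & b in [set b^-1 | b in closure (A n)]].
    apply/seteqP; split=> [_ [a Aa [b Ba <-]]|_ [a Aa [_ [b Ba <-] <-]]].
      by exists a => //; exists b^-1 => //; exists b.
    by exists a => //; exists b.
  by apply: group_boundedM; [|apply: group_boundedV]; exact: group_bounded_closure.
have qA_cover : \bigcup_n (q @` A n) = setT.
  apply/seteqP; split=> // b _; have [x <-] := quotient_map_surj b.
  have : [set: G] x by [].
  by rewrite -A_cover => -[m _ [a Aa ax]]; exists m => //; exists a.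
(* [B] lies in one term of the chain, and by induction every term is covered by the image of a
   bounded set. *)
apply: bounded_lifting_sub => B /(bounded_in_chain nqK qKV qA_cover)[m Bm].
suff [A' Ab' mA'] : liftable (coarse_chain (q @` K) (fun n => q @` A n) m).
  by exists A' => //; exact: subset_trans mA'.
elim: m {Bm} => [|m IH] /=; first by exists K.
have lA : liftable (q @` A m) by exists (A m).
by apply: liftable_cube; apply: liftableU => //; apply: liftableU => //; exact: liftableV.
Qed.

End SigmaCobounded.

Theorem theorem1 (R : realType) (G : topologicalGroupType)
    (G_polish : polish_space R G)
    (H : normalSubgroup G) (H_closed : closed [set` H])
    (GH_metrisable : coarse_metrisable R (left_coarse R (quotient_group H))) :
  [<-> left_coarse R (quotient_group H) =
         quotient_coarse (left_coarse R G) (quotient_map H);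
       forall B : set (quotient_group H), group_bounded R B ->
         exists2 A : set G, group_bounded R A & B = quotient_map H @` A;
       sigma_cobounded R [set` H];
       exists2 phi : quotient_group H -> G, is_section phi & modest R phi].
Proof.
tfae.
- exact: coarse_quotient_lifting.
- exact: lifting_sigma_cobounded.
(* (3) yields (4) by way of (2). *)
- move=> /(sigma_cobounded_lifting G_polish H_closed).
  exact: lifting_modest_section.
- by move=> [phi]; exact: modest_section_coarse.
Qed.
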